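(* Let $S$ be a non-orientable 3-divisible surface and let $pr\colon\tilde S\to S$ be its orientable double cover, with the lifted triangulation. Then $S$ admits a 2-circuit decomposition if and only if $\tilde S$ does.
   Context: Surface: a connected closed compact surface with a fixed triangulation, i.e. a finite simplicial complex whose realization is a connected closed compact 2-manifold. A surface is 3-divisible if for every vertex $v$ the number of triangles (2-simplices) containing $v$ is divisible by 3. 2-circuit: a cyclic sequence of vertices $v_1\dots v_n$ such that, with indices modulo $n$, every three adjacent terms $\{v_i,v_{i+1},v_{i+2}\}$ form a 2-simplex, and each such 2-simplex arises exactly once among the $n$ windows $i=1,\dots,n$. A 2-circuit decomposition is a collection of 2-circuits such that each 2-simplex of the surface occurs in exactly one of these circuits. *)

(* Defs.v *)
From mathcomp Require Import all_boot.

Set Implicit Arguments.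
Unset Strict Implicit.
Unset Printing Implicit Defensive.

(* A simplicial complex on the vertex set V is the set of its nonempty faces. *)
Definition simplicial_complex (V : finType) (K : {set {set V}}) : Prop :=
  [/\ forall v : V, [set v] \in K,
      set0 \notin K
    & forall s t : {set V}, s \in K -> t \subset s -> t != set0 -> t \in K].

Definition triangles (V : finType) (K : {set {set V}}) : {set {set V}} :=
  [set t in K | #|t| == 3].

Definition link (V : finType) (K : {set {set V}}) (v : V) : {set {set V}} :=
  [set t in K | (v \notin t) && (v |: t \in K)].

(* L is a polygon: a circle triangulated with at least three vertices, listed
   in cyclic order by c. *)
Definition polygon (V : finType) (L : {set {set V}}) : Prop :=
  exists c : seq V,
    [/\ uniq c, 2 < size c
      & L = [set [set x] | x in c] :|: [set [set x; next c x] | x in c]].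

(* The realization of a finite simplicial complex is a closed 2-manifold exactly
   when all its vertex links are polygons, and it is connected exactly when the
   1-skeleton is. *)
Definition surface (V : finType) (K : {set {set V}}) : Prop :=
  [/\ simplicial_complex K,
      0 < #|V|,
      forall v w : V, connect (fun x y : V => [set x; y] \in K) v w
    & forall v : V, polygon (link K v)].

Definition three_divisible (V : finType) (K : {set {set V}}) : Prop :=
  forall v : V, 3 %| #|[set t in triangles K | v \in t]|.

(* o x y z says that the ordering (x, y, z) of the triangle {x, y, z} is
   positive; its values on other triples are irrelevant.  The last clause says
   that two triangles sharing the edge {x, y} induce opposite directions on it. *)
Definition coherent_orientation (V : finType) (K : {set {set V}})
    (o : V -> V -> V -> bool) : Prop :=
  [/\ forall x y z : V, [set x; y; z] \in triangles K -> o y z x = o x y z,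
      forall x y z : V, [set x; y; z] \in triangles K -> o y x z = ~~ o x y z
    & forall x y z w : V,
        [set x; y; z] \in triangles K -> [set x; y; w] \in triangles K ->
        z != w -> o x y w = ~~ o x y z].

Definition orientable (V : finType) (K : {set {set V}}) : Prop :=
  exists o : V -> V -> V -> bool, coherent_orientation K o.

(* pr is a two-sheeted covering and L is the lifted triangulation: pr is
   simplicial, and above a vertex of a simplex s each point of the fibre lies on
   exactly one lift of s (so pr is bijective on stars and injective on every
   simplex). *)
Definition double_cover (V W : finType) (K : {set {set V}}) (L : {set {set W}})
    (pr : W -> V) : Prop :=
  [/\ forall t : {set W}, t \in L -> pr @: t \in K,
      forall (w : W) (s : {set V}), s \in K -> pr w \in s ->
        exists! t : {set W}, [/\ t \in L, w \in t & pr @: t = s]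
    & forall v : V, #|[set w | pr w == v]| = 2].

Definition orientable_double_cover (V W : finType)
    (K : {set {set V}}) (L : {set {set W}}) (pr : W -> V) : Prop :=
  [/\ surface L, orientable L & double_cover K L pr].

(* For s = [:: v_1; ...; v_n], the sequence of the n sets
   {v_i, v_(i+1), v_(i+2)}, indices modulo n. *)
Definition windows (V : finType) (s : seq V) : seq {set V} :=
  [seq [set x.1.1; x.1.2; x.2] | x <- zip (zip s (rot 1 s)) (rot 2 s)].

Definition two_circuit (V : finType) (K : {set {set V}}) (s : seq V) : Prop :=
  [/\ 0 < size s, all (fun t => t \in triangles K) (windows s)
    & uniq (windows s)].

Definition two_circuit_decomposition (V : finType) (K : {set {set V}})
    (C : seq (seq V)) : Prop :=
  (forall s : seq V, s \in C -> two_circuit K s) /\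
  (forall t : {set V}, t \in triangles K ->
     count (fun s : seq V => t \in windows s) C = 1).

Definition has_two_circuit_decomposition (V : finType) (K : {set {set V}}) :
    Prop :=
  exists C : seq (seq V), two_circuit_decomposition K C.

(* Main.v *)
Require Import Defs.
From mathcomp Require Import all_boot zify.

(** In a 2-circuit ... a, b, c, d ... the windows {a, b, c} and {b, c, d} are
    distinct triangles on the edge {b, c}, and in a closed surface an edge lies
    in exactly two triangles; so d is determined by (a, b, c), and so is the
    whole circuit.  Up to reversal, the only freedom in starting a circuit at a
    triangle is the choice of its middle vertex.  Hence a 2-circuit
    decomposition amounts to a choice of a middle vertex m t in every triangle
    t that is compatible with crossing edges: if {x, y, z} and {x, y, w} are
    the two triangles on {x, y}, the bijection x |-> y, y |-> x, z |-> w of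
    their vertices carries one middle to the other.  This is [middle_choice], a
    section of the three-sheeted covering of the dual graph whose fibre over a
    triangle is its vertex set.

    [circuit_middle_choice] reads a middle choice off a decomposition.
    Conversely, [middle_choice_decomposition] runs the permutation [step],
    (a, b, c) |-> (b, c, d), on the ordered triangles with their chosen vertex
    in the middle.  Each triangle carries two of them, exchanged by reversal,
    and no orbit is its own reverse ([iter_step_neq_flip]); so each orbit passes
    at most once through a triangle, and one orbit from every pair of mutually
    reverse orbits gives the decomposition.

    It remains to move middle choices along the double cover.  Downstairs to
    upstairs they pull back ([middle_choice_lift]).  In the other direction, a
    triangle t of the base has two lifts, whose middles project to two vertices
    p, q of t, distinct or not; the chosen vertex is p if p = q, and the third
    vertex of t otherwise.  The crossing rule is a bijection of vertices, so it
    commutes with this construction, which is therefore a middle choice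
    ([middle_choice_project]).  In terms of holonomy: a subgroup of S_3 with a
    subgroup of index at most two fixing a point fixes a point itself. *)

Set Implicit Arguments.
Unset Strict Implicit.
Unset Printing Implicit Defensive.

(** * Triangles, links and middle choices *)

Section Triangles.
Variable V : finType.
Implicit Types (x y z w : V) (K L : {set {set V}}).

Lemma cards3_eq x y z :
  (#|[set x; y; z]| == 3) = [&& x != y, x != z & y != z].
Proof.
rewrite -setUA cardsU1 cards2 !inE negb_or.
by case: (x == y); case: (x == z); case: (y == z).
Qed.

Lemma set3_swap x y z : [set x; y; z] = [set y; x; z].
Proof. by rewrite (setUC [set x]). Qed.

Lemma set3_rot x y z : [set x; y; z] = [set y; z; x].
Proof. by rewrite -setUA setUC. Qed.

Lemma set3_rev x y z : [set x; y; z] = [set z; y; x].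
Proof. by rewrite set3_swap -set3_rot. Qed.

Lemma triangle_distinct K x y z :
  [set x; y; z] \in triangles K -> [/\ x != y, x != z & y != z].
Proof. by rewrite inE cards3_eq => /andP[_ /and3P]. Qed.

(** This is what makes a strip of triangles continue across an edge, in one way
    only. *)
Definition closed_up K := forall x y z, [set x; y; z] \in triangles K ->
  exists w, [/\ w != z, [set x; y; w] \in triangles K
    & forall u, u != z -> [set x; y; u] \in triangles K -> u = w].

(** One clause of the crossing rule is enough: read from {x, y, w} to {x, y, z},
    at both ends of the edge, it also forces m {x, y, w} = w when
    m {x, y, z} = z. *)
Definition middle_choice K (m : {set V} -> V) :=
  (forall t, t \in triangles K -> m t \in t) /\
  (forall x y z w, [set x; y; z] \in triangles K ->
     [set x; y; w] \in triangles K -> z != w ->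
     m [set x; y; z] = x -> m [set x; y; w] = y).

Lemma next_neq_prev (c : seq V) x :
  uniq c -> 2 < size c -> x \in c -> next c x != prev c x.
Proof.
move=> Uc c_gt2 cx; apply/eqP => e.
have: next c (next c x) = x by rewrite e next_prev.
have [i c' Ec] := rot_to cx.
have Uc' : uniq (x :: c') by rewrite -Ec rot_uniq.
have: 2 < size (x :: c') by rewrite -Ec size_rot.
rewrite -!(next_rot i Uc) Ec; case: c' Uc' {Ec} => [|a [|b c']] //= Uc' _.
rewrite eqxx; case: eqP Uc' => [->|_]; first by rewrite !inE eqxx.
rewrite eqxx => + bx; by rewrite bx !inE eqxx orbT.
Qed.

(** The neighbours of y on the circle are the next and the previous vertex,
    which differ because the circle has more than two vertices. *)
Lemma polygon_other_neighbour L y z :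
  polygon L -> y != z -> [set y; z] \in L ->
  exists w, [/\ w != z, y != w, [set y; w] \in L
    & forall u, u != z -> y != u -> [set y; u] \in L -> u = w].
Proof.
case=> c [Uc c_gt2 ->] yz.
have edgeE a b : a != b ->
    ([set a; b] \in [set [set x] | x in c] :|: [set [set x; next c x] | x in c])
    = (a \in c) && ((b == next c a) || (b == prev c a)).
  move=> ab; rewrite inE; apply/idP/idP.
    case/orP=> /imsetP[x cx].
      move/(congr1 (fun A => #|pred_of_set A|)).
      by rewrite cards2 cards1 ab.
    move/setP=> E; move: (E a) (E b); rewrite !inE !eqxx orbT /=.
    move=> /esym/orP[]/eqP Ea /esym/orP[]/eqP Eb.
    - by rewrite Ea Eb eqxx in ab.
    - by rewrite Ea cx Eb eqxx.
    - by rewrite Ea Eb mem_next cx prev_next // eqxx orbT.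
    - by rewrite Ea Eb eqxx in ab.
  case/andP=> ca /orP[]/eqP ->; apply/orP; right; apply/imsetP.
    by exists a.
  by exists (prev c a); rewrite ?mem_prev // next_prev // setUC.
rewrite edgeE // => /andP[cy nz].
have NP := next_neq_prev Uc c_gt2 cy.
have yn : y != next c y.
  by apply: contraNneq NP => e; rewrite -e -{1}(prev_next Uc y) -e.
have yp : y != prev c y.
  by apply: contraNneq NP => e; rewrite -e -{2}(next_prev Uc y) -e.
case/orP: nz => /eqP ->; [exists (prev c y)|exists (next c y)]; split=> //.
- by rewrite eq_sym.
- by rewrite edgeE // cy eqxx orbT.
- by move=> u /negPf uz uy; rewrite edgeE // cy uz => /eqP.
- by rewrite edgeE // cy eqxx.
by move=> u /negPf uz uy; rewrite edgeE // cy uz orbF => /eqP.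
Qed.

(** The triangles on the edge {x, y} are the edges at y in the link of x. *)
Lemma surface_closed_up K : surface K -> closed_up K.
Proof.
case=> [[K1 K0 Ksub] _ _ Klink] x y z tri.
have [xy xz yz] := triangle_distinct tri.
have link2 u : x != y -> x != u -> y != u ->
    ([set y; u] \in link K x) = ([set x; y; u] \in triangles K).
  move=> xy' xu yu.
  rewrite !inE cards3_eq xy' xu yu andbT negb_or xy' xu /= setUA.
  rewrite andbT; apply/andP/idP => [[]//|Kt]; split=> //.
  apply: Ksub Kt _ _; first by rewrite -setUA subsetUr.
  by apply/set0Pn; exists y; rewrite !inE eqxx.
have vertex_link u : [set y; u] \in link K x -> x != u.
  by rewrite !inE negb_or => /and3P[_ /andP[]].
have [|w [wz yw Lw w_uniq]] := polygon_other_neighbour (Klink x) yz.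
  by rewrite link2.
exists w; split=> // [|u uz tu]; first by rewrite -link2 // vertex_link.
by have [_ xu yu] := triangle_distinct tu; apply: w_uniq; rewrite ?link2.
Qed.

Lemma triangle_shape K t v :
  t \in triangles K -> v \in t -> exists a c, t = [set a; v; c].
Proof.
move=> Kt tv; have /cards2P[a [c [ac E]]] : #|t :\ v| == 2.
  by move: Kt; rewrite inE (cardsD1 v t) tv => /andP[_].
by exists a, c; rewrite -[LHS](setD1K tv) E setUA; apply: set3_swap.
Qed.

End Triangles.

(** * Middle choices from circuits *)

Lemma head_filter (T : eqType) (a : pred T) (r : seq T) x x0 :
  count a r = 1 -> x \in r -> a x -> head x0 (filter a r) = x.
Proof.
move=> c1 rx ax; have: x \in filter a r by rewrite mem_filter ax.
move: c1; rewrite -size_filter; case: (filter a r) => [|y []] //= _.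
by rewrite inE => /eqP ->.
Qed.

Section Circuits.
Variables (V : finType) (v0 : V).
Implicit Types (s : seq V) (K : {set {set V}}).

(** Indices run over all of nat and are read modulo the length, so that windows
    shift without wrap-around cases. *)
Definition cyc s i := nth v0 s (i %% size s).
Definition window s i := [set cyc s i; cyc s i.+1; cyc s i.+2].

Lemma cyc_modn s i j : i = j %[mod size s] -> cyc s i = cyc s j.
Proof. by rewrite /cyc => ->. Qed.

Lemma window_modn s i j : i = j %[mod size s] -> window s i = window s j.
Proof.
have shift k a b : a = b %[mod size s] -> a + k = b + k %[mod size s].
  by move/eqP=> e; apply/eqP; rewrite eqn_modDr.
move=> e; rewrite /window (cyc_modn e) (@cyc_modn s i.+1 j.+1).
  by rewrite (@cyc_modn s i.+2 j.+2) // -(addn2 i) -(addn2 j) (shift _ _ _ e).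
by rewrite -(addn1 i) -(addn1 j) (shift _ _ _ e).
Qed.

Lemma nth_rot_cyc s k i :
  k <= size s -> i < size s -> nth v0 (rot k s) i = cyc s (i + k).
Proof.
move=> ks si; rewrite /rot nth_cat size_drop nth_drop /cyc.
have [lt|ge] := ltnP; first by rewrite addnC modn_small //; lia.
rewrite nth_take; last lia.
have -> : i + k = (i - (size s - k)) + size s by lia.
by rewrite modnDr modn_small //; lia.
Qed.

Lemma windowsE s : 1 < size s -> windows s = mkseq (window s) (size s).
Proof.
move=> s_gt1; have sz k : size (rot k s) = size s by rewrite size_rot.
have sw : size (windows s) = size s.
  by rewrite size_map !size_zip !sz !minnn.
apply: (@eq_from_nth _ set0); rewrite ?size_mkseq // sw => i si.
rewrite nth_mkseq // (nth_map (v0, v0, v0)) ?size_zip ?sz ?minnn //.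
rewrite !nth_zip ?size_zip ?sz ?minnn //= !nth_rot_cyc ?(ltnW s_gt1) //.
by rewrite addn1 addn2 /window {3}/cyc modn_small.
Qed.

Lemma two_circuit_size K s : two_circuit K s -> 1 < size s.
Proof.
case: s => [|a [|b s]] [] //= _; rewrite andbT => /triangle_distinct[].
by rewrite eqxx.
Qed.

Lemma window_mem s i : 1 < size s -> window s i \in windows s.
Proof.
move=> s1; rewrite windowsE //; apply/mapP; exists (i %% size s).
  by rewrite mem_iota ltn_mod (ltnW s1).
by apply: window_modn; rewrite modn_mod.
Qed.

Lemma window_triangle K s i : two_circuit K s -> window s i \in triangles K.
Proof.
move=> cs; have s1 := two_circuit_size cs; case: cs => _ /allP sK _.
exact/sK/window_mem.
Qed.

Lemma index_window K s i :
  two_circuit K s -> index (window s i) (windows s) = i %% size s.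
Proof.
move=> cs; have s1 := two_circuit_size cs; case: cs => _ _ Us.
have si : i %% size s < size s by rewrite ltn_mod (ltnW s1).
rewrite (@window_modn s i (i %% size s)) ?modn_mod //.
rewrite -(nth_mkseq set0 (window s) si) -windowsE // index_uniq //.
by rewrite windowsE // size_mkseq.
Qed.

(** By the uniqueness of windows: a circuit never turns back across an edge. *)
Lemma windowS_neq K s i : two_circuit K s -> window s i != window s i.+1.
Proof.
move=> cs; have s1 := two_circuit_size cs.
apply/eqP=> e; have := index_window i.+1 cs; rewrite -e (index_window i cs).
move/eqP; rewrite -addn1 -{1}(addn0 i) eqn_modDl mod0n modn_small //.
Qed.

Definition circuit_through (C : seq (seq V)) (t : {set V}) : seq V :=
  head [::] [seq s <- C | t \in windows s].

Definition circuit_middle C t : V :=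
  let s := circuit_through C t in cyc s (index t (windows s)).+1.

Lemma circuit_middle_window K C s i : two_circuit_decomposition K C ->
  s \in C -> circuit_middle C (window s i) = cyc s i.+1.
Proof.
move=> [CK cover] Cs; have cs := CK s Cs; have s1 := two_circuit_size cs.
have -> : circuit_middle C (window s i)
    = cyc s (index (window s i) (windows s)).+1.
  rewrite /circuit_middle; suff -> : circuit_through C (window s i) = s by [].
  by apply: head_filter; rewrite ?window_mem ?(cover _ (window_triangle i cs)).
rewrite (index_window i cs); apply: cyc_modn.
by apply/eqP; rewrite -!(addn1 (_ %% _)) -(addn1 i) eqn_modDr modn_mod.
Qed.

(** Let x be the middle of {x, y, z} in its circuit.  Then y is its predecessor
    or successor there, so the circuit also has a window at {x, y} on the other
    side, whose middle is y. *)
Lemma circuit_middle_choice K C : closed_up K ->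
  two_circuit_decomposition K C -> middle_choice K (circuit_middle C).
Proof.
move=> clK dC; have [CK cover] := dC.
have windowP t : t \in triangles K ->
    exists s i, [/\ s \in C, two_circuit K s & t = window s i.+1].
  move/cover => c1.
  have: has (fun s => t \in windows s) C by rewrite has_count c1.
  case/hasP=> s Cs; have cs := CK s Cs; have s1 := two_circuit_size cs.
  (* a successor index, so that the preceding window has an index too *)
  rewrite windowsE // => /mapP[i _ ->]; exists s, (i + (size s).-1); split=> //.
  by apply: window_modn; rewrite -addnS prednK ?modnDr // (ltnW s1).
split=> [t /windowP[s [i [Cs _ ->]]]|].
  by rewrite (circuit_middle_window _ dC Cs) /window !inE eqxx orbT.
move=> x y z w Kz Kw zw; have [s [i [Cs cs E]]] := windowP _ Kz.
have [u [uz Ku u_uniq]] := clK _ _ _ Kz.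
have wu : w = u by apply: u_uniq => //; rewrite eq_sym.
have [xy xz yz] := triangle_distinct Kz.
rewrite E (circuit_middle_window _ dC Cs) => Ex.
have: y \in window s i.+1 by rewrite -E !inE eqxx orbT.
(* the other window of the circuit meeting the edge {x, y} is the triangle
   across that edge *)
have other j q : [set x; y; q] = window s j -> window s j != window s i.+1 ->
    circuit_middle C [set x; y; w] = cyc s j.+1.
  move=> Ej ne; suff -> : w = q by rewrite Ej (circuit_middle_window _ dC Cs).
  rewrite wu; apply/esym/u_uniq; last by rewrite Ej window_triangle.
  by apply: contraNneq ne => qz; rewrite -Ej qz E.
rewrite !inE Ex (eq_sym y x) (negPf xy) orbF => /orP[]/eqP Ey.
  rewrite (other i (cyc s i)) ?Ex -?Ey ?(windowS_neq i cs) //.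
  by rewrite /window -Ey Ex -set3_rot set3_swap set3_rot.
rewrite (other i.+2 (cyc s i.+4)) ?Ey // 1?eq_sym ?(windowS_neq _ cs) //.
by rewrite /window Ex.
Qed.

End Circuits.

(** * Circuits from middle choices *)

Section Strips.
Variables (V : finType) (K : {set {set V}}) (m : {set V} -> V).
Hypotheses (clK : closed_up K) (mK : middle_choice K m).

Local Notation flag := (V * V * V)%type.
Implicit Types x y : flag.

Definition face x := [set x.1.1; x.1.2; x.2].
Definition flip x : flag := (x.2, x.1.2, x.1.1).
Definition middle_flag x := (face x \in triangles K) && (m (face x) == x.1.2).

(** Staying put outside the middle flags makes the step a permutation of the
    whole finite type of flags, so that its orbits are cycles. *)
Definition step x : flag :=
  if middle_flag x then
    (x.1.2, x.2,
     odflt x.2 [pick d | (d != x.1.1) && ([set x.1.2; x.2; d] \in triangles K)])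
  else x.

Lemma flipK : involutive flip.
Proof. by case=> [[a b] c]. Qed.

Lemma face_flip x : face (flip x) = face x.
Proof. exact: set3_rev. Qed.

Lemma middle_flip x : middle_flag (flip x) = middle_flag x.
Proof. by rewrite /middle_flag face_flip. Qed.

Lemma stepP a b c : middle_flag (a, b, c) ->
  exists d, [/\ step (a, b, c) = (b, c, d), middle_flag (b, c, d), d != a
    & forall e, e != a -> [set b; c; e] \in triangles K -> e = d].
Proof.
move=> mx; rewrite /step mx /=; case/andP: (mx); rewrite /face /= => Kx /eqP mE.
rewrite set3_rot in Kx mE.
have [d [da Kd d_uniq]] := clK Kx.
exists d; split=> //.
  case: pickP => [e /andP[ea Ke]|/(_ d)]; last by rewrite da Kd.
  by rewrite /= (d_uniq e).
rewrite /middle_flag /face /= Kd; apply/eqP.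
by apply: mK.2 Kx Kd _ mE; rewrite eq_sym.
Qed.

Lemma middle_step x : middle_flag (step x) = middle_flag x.
Proof.
have [|nx] := boolP (middle_flag x); last by rewrite /step !(negPf nx).
by case: x => [[a b] c] /stepP[d [-> -> _ _]].
Qed.

(** If d lies across the edge {b, c} from a, then a lies across it from d: in
    reversed order, the step runs backwards. *)
Lemma step_flip_step x : middle_flag x -> step (flip (step x)) = flip x.
Proof.
case: x => [[a b] c] mx; have [d [-> md da _]] := stepP mx.
have [|e [-> _ _]] := @stepP d c b; first by rewrite -middle_flip in md.
move=> e_uniq; rewrite /flip /= -(e_uniq a) 1?eq_sym //.
rewrite -[[set _; _; _]]/(face (flip (a, b, c))) face_flip.
by case/andP: mx.
Qed.

Lemma step_inj : injective step.
Proof.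
move=> x y E; have mE: middle_flag x = middle_flag y.
  by rewrite -(middle_step x) E middle_step.
have [mx|nx] := boolP (middle_flag x).
  have my : middle_flag y by rewrite -mE.
  apply: (can_inj flipK).
  by rewrite -(step_flip_step mx) -(step_flip_step my) E.
by move: E; rewrite /step -mE (negPf nx).
Qed.

Lemma middle_iter k x : middle_flag (iter k step x) = middle_flag x.
Proof. by elim: k => //= k IH; rewrite middle_step. Qed.

Lemma middle_flag_distinct a b c :
  middle_flag (a, b, c) -> [/\ a != b, a != c & b != c].
Proof. by case/andP=> /triangle_distinct. Qed.

(** If f denotes the step and r the reversal, f^(k+2) x = r x gives
    f^k (f x) = r (f x), so that k can be lowered to 0 or 1.  There,
    (a, b, c) = (c, b, a) or (b, c, d) = (c, b, a), although a, b, c are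
    distinct. *)
Lemma iter_step_neq_flip k x : middle_flag x -> iter k step x != flip x.
Proof.
elim/ltn_ind: k x => -[|[|k]] IH [[a b] c] mx.
- by have [_ ac _] := middle_flag_distinct mx; apply: contraNneq ac => -[->].
- have [_ _ bc] := middle_flag_distinct mx; have [d [/= -> _ _ _]] := stepP mx.
  by apply: contraNneq bc => -[->].
set x := (a, b, c) in mx *.
rewrite iterS -(step_flip_step mx) (inj_eq step_inj) iterSr.
by apply: IH; rewrite ?middle_step.
Qed.

Lemma eq_face x y :
  middle_flag x -> middle_flag y -> face x = face y -> y = x \/ y = flip x.
Proof.
case: x y => [[a b] c] [[a' b'] c'] mx my E.
have Eb : b' = b.
  by case/andP: mx my => _ /eqP /= <- /andP[_ /eqP /= <-]; rewrite E.
rewrite {}Eb in my E *; rewrite /flip /=.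
have [ab ac bc] := middle_flag_distinct mx.
have [ab' ac' bc'] := middle_flag_distinct my.
move/setP: E => E; move: (E a') (E c').
rewrite /face /= !inE !eqxx !orbT /=.
rewrite (negPf ab') (eq_sym c' b) (negPf bc') !orbF.
move=> /orP[]/eqP Ea /orP[]/eqP Ec; subst.
- by rewrite eqxx in ac'.
- by left.
- by right.
- by rewrite eqxx in ac'.
Qed.

Definition strip x : {set {set V}} := [set face y | y in orbit step x].

Lemma sub_strip x y : fconnect step x y -> strip y \subset strip x.
Proof.
move=> xy; apply/subsetP=> _ /imsetP[z zy ->]; apply/imsetP; exists z => //.
by rewrite -fconnect_orbit (connect_trans xy) // fconnect_orbit.
Qed.

Lemma strip_connect x y : fconnect step x y -> strip y = strip x.
Proof.
move=> xy; apply/eqP; rewrite eqEsubset !sub_strip //.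
by rewrite fconnect_sym //; apply: step_inj.
Qed.

Lemma sub_strip_flip x : middle_flag x -> strip x \subset strip (flip x).
Proof.
move=> mx; apply/subsetP=> _ /imsetP[y + ->].
rewrite -fconnect_orbit => /iter_findex <-.
elim: (findex _ _ _) => [|k IH].
  by rewrite -face_flip imset_f // -fconnect_orbit.
rewrite -face_flip imset_f // -fconnect_orbit.
elim: k.+1 => //= n; move/connect_trans; apply.
rewrite fconnect_sym; last exact: step_inj.
by rewrite -[flip (iter n _ _)]step_flip_step ?middle_iter // fconnect1.
Qed.

Lemma strip_flip x : middle_flag x -> strip (flip x) = strip x.
Proof.
move=> mx; apply/eqP; rewrite eqEsubset sub_strip_flip // andbT.
by rewrite -{2}(flipK x) sub_strip_flip // middle_flip.
Qed.

Lemma mem_strip x t : middle_flag x -> t \in strip x ->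
  exists2 y, middle_flag y & t = face y /\ strip y = strip x.
Proof.
move=> mx /imsetP[y]; rewrite -fconnect_orbit => xy ->; exists y.
  by rewrite -(iter_findex xy) middle_iter.
by split=> //; apply: strip_connect.
Qed.

(** Two middle flags on one triangle are equal or reverse to each other, and
    reverse flags run through the same triangles. *)
Lemma strip_disjoint x y t : middle_flag x -> middle_flag y ->
  t \in strip x -> t \in strip y -> strip x = strip y.
Proof.
move=> mx my /(mem_strip mx)[x' mx' [-> <-]] /(mem_strip my)[y' my' [E <-]].
by have [->|->] := eq_face mx' my' E; rewrite ?strip_flip.
Qed.

Definition strip_circuit x := [seq y.1.1 | y <- orbit step x].

(** The other two components of a flag are the first components of its next two
    iterates, and on an orbit iterating the step is the same as rotating. *)
Lemma strip_circuit_windows x :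
  middle_flag x -> windows (strip_circuit x) = [seq face y | y <- orbit step x].
Proof.
move=> mx; rewrite /windows /strip_circuit.
set p := orbit step x.
have mp y : y \in p -> middle_flag y.
  by rewrite -fconnect_orbit => xy; rewrite -(iter_findex xy) middle_iter.
have rot1 : rot 1 p = map step p.
  have [q Eq] : exists q, p = x :: q by rewrite /p /orbit -orderSpred; eexists.
  have := cycle_orbit step_inj x; rewrite -/p Eq /= rot1_cons.
  elim: q {1 4}x {Eq} => [|b q IH] a /=; first by case/andP=> /eqP <-.
  by case/andP=> /eqP <- /IH ->.
have rot2 : rot 2 p = map step (map step p).
  have sp : 1 < size p.
    have px : x \in p by rewrite -fconnect_orbit.
    have psx : step x \in p by rewrite -fconnect_orbit fconnect1.
    case: p px psx {mp rot1} => [|y [|]] //=; rewrite !inE => /eqP <-.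
    case: x mx => [[a b] c] mx; have [d [-> _ _ _]] := stepP mx.
    have [ab _ _] := middle_flag_distinct mx.
    by case/eqP=> e; rewrite e eqxx in ab.
  by rewrite -[2]/(1 + 1) rotD // rot1 -map_rot rot1.
rewrite -!map_rot rot2 rot1 -!map_comp !zip_map -map_comp.
apply/eq_in_map => y /mp.
case: y => [[a b] c] my /=; have [d [E md _ _]] := stepP my.
have [e [E' _ _ _]] := stepP md.
by rewrite E E'.
Qed.

(** A triangle met twice would be met by two flags reverse to each other. *)
Lemma strip_circuit_two_circuit x :
  middle_flag x -> two_circuit K (strip_circuit x).
Proof.
move=> mx; rewrite /two_circuit strip_circuit_windows //.
have mp y : y \in orbit step x -> middle_flag y.
  by rewrite -fconnect_orbit => xy; rewrite -(iter_findex xy) middle_iter.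
split.
- by rewrite size_map size_orbit.
- by apply/allP=> _ /mapP[y /mp/andP[Ky _] ->].
rewrite map_inj_in_uniq ?orbit_uniq // => y z py pz E.
have [//|zf] := eq_face (mp _ py) (mp _ pz) E.
have yz : fconnect step y z.
  apply: (@connect_trans _ _ x); last by rewrite fconnect_orbit.
  by rewrite fconnect_sym ?fconnect_orbit //; apply: step_inj.
by have := iter_step_neq_flip (findex step y z) (mp _ py);
  rewrite iter_findex // zf eqxx.
Qed.

Lemma triangle_middle_flag t : t \in triangles K ->
  exists2 x, middle_flag x & face x = t.
Proof.
move=> Kt; have [a [c Et]] := triangle_shape Kt (mK.1 t Kt).
by exists (a, m t, c) => //; rewrite /middle_flag /face /= -Et Kt eqxx.
Qed.

(** The strips partition the triangles, so one circuit per strip covers each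
    triangle once. *)
Lemma middle_choice_decomposition : has_two_circuit_decomposition K.
Proof.
pose strips := [set strip x | x : V * V * V & middle_flag x].
have repP B : B \in strips -> exists x, middle_flag x && (strip x == B).
  by case/imsetP=> x; rewrite inE => mx ->; exists x; rewrite mx eqxx.
(* A strip carries two circuits, reverse to each other; the choice of a flag
   keeps one of them. *)
pose rep (B : {set {set V}}) : seq V :=
  oapp strip_circuit [::] [pick x | middle_flag x && (strip x == B)].
have repE B : B \in strips ->
    exists x, [/\ middle_flag x, strip x = B & rep B = strip_circuit x].
  move/repP=> [x0 Hx0]; rewrite /rep.
  case: pickP => [x /andP[mx /eqP xB]|/(_ x0)]; last by rewrite Hx0.
  by exists x.
exists [seq rep B | B <- enum strips]; split.
  move=> _ /mapP[B + ->]; rewrite mem_enum => /repE[x [mx _ ->]].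
  exact: strip_circuit_two_circuit.
move=> t /triangle_middle_flag[x mx xt].
have Sx : strip x \in strips by apply: imset_f; rewrite inE.
have tx : t \in strip x by rewrite -xt imset_f // -fconnect_orbit.
rewrite count_map (@eq_in_count _ _ (pred1 (strip x))) => [|B].
  by rewrite count_uniq_mem ?enum_uniq // mem_enum Sx.
rewrite mem_enum => /repE[y [my yB rB]] /=.
have -> : (t \in windows (rep B)) = (t \in strip y).
  rewrite rB strip_circuit_windows //.
  by apply/mapP/imsetP => -[z yz ->]; exists z.
rewrite -yB; apply/idP/eqP => [ty|->//].
exact: strip_disjoint ty tx.
Qed.

End Strips.

(** * Middle choices along a double cover *)

Section Cover.
Variables (V W : finType) (K : {set {set V}}) (L : {set {set W}}) (pr : W -> V).
Hypotheses (scK : simplicial_complex K) (scL : simplicial_complex L).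
Hypothesis cov : double_cover K L pr.

(** If x, y in t have the same image, {x} and {x, y} are two lifts at x of the
    vertex pr x. *)
Lemma simplex_inj t : t \in L -> {in t &, injective pr}.
Proof.
move=> Lt x y tx ty E; have [L1 _ Lsub] := scL.
have [_ lift _] := cov.
have Lxy : [set x; y] \in L.
  apply: Lsub Lt _ _; first by rewrite subUset !sub1set tx.
  by apply/set0Pn; exists x; rewrite !inE eqxx.
have [||s [_ uniq]] := lift x [set pr x]; rewrite ?inE //; first by case: scK.
have /uniq sx : [/\ [set x] \in L, x \in [set x] & pr @: [set x] = [set pr x]].
  by rewrite inE imset_set1.
have /uniq sxy : [/\ [set x; y] \in L, x \in [set x; y]
    & pr @: [set x; y] = [set pr x]].
  by rewrite !inE eqxx imsetU !imset_set1 -E setUid.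
have: y \in [set x; y] by rewrite !inE eqxx orbT.
by rewrite -sxy sx inE => /eqP.
Qed.

Lemma card_image_simplex t : t \in L -> #|pr @: t| = #|t|.
Proof. by move/simplex_inj/card_in_imset. Qed.

Lemma image_triangle t : t \in triangles L -> pr @: t \in triangles K.
Proof.
rewrite !inE => /andP[Lt t3]; rewrite card_image_simplex // t3 andbT.
by case: cov => imK _ _; apply: imK.
Qed.

Lemma imset_set3 x y z : pr @: [set x; y; z] = [set pr x; pr y; pr z].
Proof. by rewrite !imsetU !imset_set1. Qed.

Lemma lift_ex w (s : {set V}) : s \in K -> pr w \in s ->
  exists2 t, [/\ t \in L, w \in t & pr @: t = s]
    & forall t', t' \in L -> w \in t' -> pr @: t' = s -> t' = t.
Proof.
move=> Ks ws; have [_ lift _] := cov; have [t [Ht t_uniq]] := lift w s Ks ws.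
by exists t => // t' *; apply/esym/t_uniq.
Qed.

Lemma lift_uniq w t t' : t \in L -> t' \in L -> w \in t -> w \in t' ->
  pr @: t = pr @: t' -> t = t'.
Proof.
move=> Lt Lt' wt wt' E; have [imK _ _] := cov.
have [s _ s_uniq] := lift_ex (imK t Lt) (imset_f pr wt).
by rewrite (s_uniq t) // (s_uniq t').
Qed.

(** The projection is injective on triangles, so the middle has a unique vertex
    over it; and by uniqueness of lifts, two triangles on a common edge have
    different images, so the crossing rule below applies to them. *)
Lemma middle_choice_lift (w0 : W) m :
  middle_choice K m -> exists m', middle_choice L m'.
Proof.
move=> [m_in m_edge].
pose m' (t : {set W}) : W := odflt w0 [pick w in t | pr w == m (pr @: t)].
have m'P t : t \in triangles L -> m' t \in t /\ pr (m' t) = m (pr @: t).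
  move=> Lt; have /imsetP[w wt Ew] := m_in _ (image_triangle Lt).
  rewrite /m'; case: pickP => [w' /andP[w't /eqP]|/(_ w)]; first by [].
  by rewrite wt Ew eqxx.
have simplex t : t \in triangles L -> t \in L by rewrite inE => /andP[].
exists m'; split=> [t /m'P[]//|x y z w Lz Lw zw E].
have [my Emy] := m'P _ Lw; have [_] := m'P _ Lz.
rewrite E imset_set3 => /esym Em.
apply: (simplex_inj (simplex _ Lw)) => //; first by rewrite !inE eqxx orbT.
rewrite Emy imset_set3; apply: m_edge Em.
- by rewrite -imset_set3 image_triangle.
- by rewrite -imset_set3 image_triangle.
apply: contraNneq zw => pzw.
have Ezw : [set x; y; z] = [set x; y; w].
  apply: (@lift_uniq x); [exact: simplex|exact: simplex| | |].
  - by rewrite !inE eqxx.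
  - by rewrite !inE eqxx.
  by rewrite !imset_set3 pzw.
have [_ xz yz] := triangle_distinct Lz.
have: z \in [set x; y; w] by rewrite -Ezw !inE eqxx !orbT.
by rewrite !inE (eq_sym z x) (negPf xz) (eq_sym z y) (negPf yz).
Qed.

Definition lift w (t : {set V}) : {set W} :=
  odflt set0 [pick t' in L | (w \in t') && (pr @: t' == t)].

Lemma liftP w t : t \in K -> pr w \in t ->
  [/\ lift w t \in L, w \in lift w t & pr @: lift w t = t].
Proof.
move=> Kt wt; have [t' [Lt' wt' Et'] _] := lift_ex Kt wt.
rewrite /lift; case: pickP => [s /and3P[Ls ws /eqP Es]|/(_ t')] //.
by rewrite Lt' wt' Et' eqxx.
Qed.

Lemma liftE w t : t \in L -> w \in t -> lift w (pr @: t) = t.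
Proof.
move=> Lt wt; have [imK _ _] := cov.
have [L1 w1 E] := liftP (imK t Lt) (imset_f pr wt).
exact: (lift_uniq L1 Lt w1 wt E).
Qed.

Lemma lift_triangle w t :
  t \in triangles K -> pr w \in t -> lift w t \in triangles L.
Proof.
rewrite !inE => /andP[Kt t3] wt; have [Lt _ E] := liftP Kt wt.
by rewrite Lt -card_image_simplex // E.
Qed.

Variable m : {set W} -> W.
Hypothesis mL : middle_choice L m.

Definition lifts_over (t : {set V}) v : nat :=
  #|[set t' in L | (pr @: t' == t) && (pr (m t') == v)]|.

(** Lifts of t correspond to points over any fixed vertex x of t.  This lets two
    triangles on a common edge {x, y} be compared lift by lift. *)
Lemma lifts_over_fibre t x v : t \in K -> x \in t ->
  lifts_over t v = #|[set w | (pr w == x) && (pr (m (lift w t)) == v)]|.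
Proof.
move=> Kt xt; rewrite /lifts_over.
rewrite -(@card_in_imset _ _ (lift^~ t)); last first.
  move=> w w'; rewrite !inE => /andP[/eqP wx _] /andP[/eqP w'x _] E.
  have [Lw ww _] := liftP Kt (etrans (congr1 (fun v => v \in t) wx) xt).
  have [_ w'w' _] := liftP Kt (etrans (congr1 (fun v => v \in t) w'x) xt).
  by apply: (simplex_inj Lw) => //; rewrite ?wx ?w'x // E.
apply: eq_card => t'; rewrite !inE; apply/and3P/imsetP => [[Lt' /eqP E Ev]|].
  move: (xt); rewrite -E => /imsetP[w wt' wx].
  by exists w; rewrite ?inE -?E -?wx ?eqxx /= ?liftE.
case=> w; rewrite inE => /andP[/eqP wx Ev] ->.
by have [Lw ww ->] := liftP Kt (etrans (congr1 (fun v => v \in t) wx) xt).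
Qed.

Lemma sum_lifts_over x y z : [set x; y; z] \in triangles K ->
  lifts_over [set x; y; z] x + lifts_over [set x; y; z] y
  + lifts_over [set x; y; z] z = 2.
Proof.
move=> Kt; have [xy xz yz] := triangle_distinct Kt.
set t := [set x; y; z] in Kt *.
have xt : x \in t by rewrite !inE eqxx.
have K' : t \in K by move: Kt; rewrite inE => /andP[].
have [_ _ /(_ x) <-] := cov.
rewrite !(@lifts_over_fibre t x) // -!sum1_card.
rewrite -addnA [RHS](bigID (fun w => pr (m (lift w t)) == x)) /=.
congr (_ + _); first by apply: eq_bigl => w; rewrite !inE.
rewrite [RHS](bigID (fun w => pr (m (lift w t)) == y)) /=.
congr (_ + _); apply: eq_bigl => w; rewrite !inE.
  case: (altP (_ =P y)) => [->|]; rewrite ?andbF //.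
  by rewrite (eq_sym y x) (negPf xy) !andbT.
have [/eqP wx|] //= := boolP (pr w == x).
have wt : pr w \in t by rewrite wx.
have mt := mL.1 _ (lift_triangle Kt wt).
have [_ _ E] := liftP K' wt.
have: pr (m (lift w t)) \in t by rewrite -{2}E imset_f.
rewrite !inE; case: eqP => [->|] /=; first by rewrite (negPf xz).
by case: eqP => [->|] /=; first by rewrite (negPf yz).
Qed.

Lemma triangle_preimage t x y z : t \in triangles L ->
  pr @: t = [set x; y; z] ->
  exists p q r, [/\ pr p = x, pr q = y, pr r = z & t = [set p; q; r]].
Proof.
move=> Lt E.
have /imsetP[p tp px] : x \in pr @: t by rewrite E !inE eqxx.
have /imsetP[q tq qy] : y \in pr @: t by rewrite E !inE eqxx orbT.
have /imsetP[r tr rz] : z \in pr @: t by rewrite E !inE eqxx orbT.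
exists p, q, r; split=> //; apply/esym/eqP.
rewrite eqEcard !subUset !sub1set tp tq tr.
have := image_triangle Lt; rewrite E => /triangle_distinct[xy xz yz].
have -> : #|[set p; q; r]| = 3.
  apply/eqP; rewrite cards3_eq; apply/and3P; split.
  - by apply: contraNneq xy => e; rewrite px qy e.
  - by apply: contraNneq xz => e; rewrite px rz e.
  - by apply: contraNneq yz => e; rewrite qy rz e.
by move: Lt; rewrite inE => /andP[_ /eqP ->].
Qed.

(** The lifts at p of the two triangles on {x, y} share the lift of that edge,
    so the crossing rule upstairs applies to them. *)
Lemma lift_across x y z w p : [set x; y; z] \in triangles K ->
  [set x; y; w] \in triangles K -> z != w -> pr p = x ->
  pr (m (lift p [set x; y; z])) = x -> pr (m (lift p [set x; y; w])) = y.
Proof.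
move=> Kz Kw zw px.
have sK t : t \in triangles K -> t \in K by rewrite inE => /andP[].
have pt c : pr p \in [set x; y; c] by rewrite px !inE eqxx.
have [Lz pz Ez] := liftP (sK _ Kz) (pt z).
have [Lw pw Ew] := liftP (sK _ Kw) (pt w).
have Tz := lift_triangle Kz (pt z); have Tw := lift_triangle Kw (pt w).
have [p1 [q [r [p1x qy rz Etz]]]] := triangle_preimage Tz Ez.
have [p2 [q' [s [p2x q'y sw Etw]]]] := triangle_preimage Tw Ew.
have p1E : p1 = p.
  by apply: (simplex_inj Lz) => //; rewrite ?px // Etz !inE eqxx.
have p2E : p2 = p.
  by apply: (simplex_inj Lw) => //; rewrite ?px // Etw !inE eqxx.
rewrite {}p1E in p1x Etz; rewrite {}p2E in p2x Etw.
(* both lifts contain the lift at p of the edge {x, y} *)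
have edgeL t a : t \in L -> p \in t -> a \in t -> [set p; a] \in L.
  have [_ _ Lsub] := scL; move=> Lt tp ta; apply: Lsub Lt _ _.
    by rewrite subUset !sub1set tp.
  by apply/set0Pn; exists p; rewrite !inE eqxx.
have Eq : q' = q.
  have Epq : [set p; q'] = [set p; q].
    apply: (@lift_uniq p); rewrite ?inE ?eqxx //.
    - by apply: edgeL Lw _ _; rewrite // Etw !inE eqxx orbT.
    - by apply: edgeL Lz _ _; rewrite // Etz !inE eqxx orbT.
    - by rewrite !imsetU !imset_set1 qy q'y.
  have: q' \in [set p; q] by rewrite -Epq !inE eqxx orbT.
  rewrite !inE => /orP[/eqP e|/eqP //].
  by have [xy _ _] := triangle_distinct Kz; rewrite -q'y e px eqxx in xy.
rewrite {}Eq in q'y Etw.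
move=> mx; rewrite Etw -qy; congr pr.
apply: (mL.2 p q r s); rewrite -?Etz -?Etw //.
  by apply: contraNneq zw => e; rewrite -rz -sw e.
apply: (simplex_inj Lz) => //; last by rewrite mx px.
exact: mL.1 Tz.
Qed.

Lemma lifts_over_edge_le x y z w : [set x; y; z] \in triangles K ->
  [set x; y; w] \in triangles K -> z != w ->
  lifts_over [set x; y; z] x <= lifts_over [set x; y; w] y.
Proof.
move=> Kz Kw zw.
have sK t : t \in triangles K -> t \in K by rewrite inE => /andP[].
rewrite !(@lifts_over_fibre _ x); [|exact: sK|by rewrite !inE eqxx|exact: sK
  |by rewrite !inE eqxx].
apply/subset_leq_card/subsetP => p; rewrite !inE => /andP[/eqP px /eqP mp].
by rewrite px (lift_across Kz Kw zw px mp) !eqxx.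
Qed.

(** One direction of the crossing rule gives an inequality between counts, and
    exchanging the two triangles gives the converse; the third equality follows
    from the total. *)
Lemma lifts_over_edge x y z w : [set x; y; z] \in triangles K ->
  [set x; y; w] \in triangles K -> z != w ->
  [/\ lifts_over [set x; y; z] x = lifts_over [set x; y; w] y,
      lifts_over [set x; y; z] y = lifts_over [set x; y; w] x
    & lifts_over [set x; y; z] z = lifts_over [set x; y; w] w].
Proof.
move=> Kz Kw zw.
have [Sz Sw] := (sum_lifts_over Kz, sum_lifts_over Kw).
have le1 := lifts_over_edge_le Kz Kw zw.
have wz : w != z by rewrite eq_sym.
have le2 := lifts_over_edge_le Kw Kz wz.
rewrite set3_swap in Kz; rewrite set3_swap in Kw.
have := lifts_over_edge_le Kw Kz wz; have := lifts_over_edge_le Kz Kw zw.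
rewrite ![[set y; x; _]]set3_swap => le3 le4.
by split; lia.
Qed.

(** The counts of the three vertices of t are 2, 0, 0 if the middles of the
    lifts project to the same vertex, and 1, 1, 0 otherwise: the vertex to be
    chosen is the one whose count differs from the other two. *)
Definition balanced (t : {set V}) v : bool :=
  [forall a in t :\ v, forall b in t :\ v, lifts_over t a == lifts_over t b].

Lemma balancedE x y z : [set x; y; z] \in triangles K ->
  balanced [set x; y; z] x
  = (lifts_over [set x; y; z] y == lifts_over [set x; y; z] z).
Proof.
move=> /triangle_distinct[xy xz yz]; set t := [set x; y; z].
have -> : balanced t x = [forall a in [set y; z], forall b in [set y; z],
                            lifts_over t a == lifts_over t b].
  rewrite /balanced; suff -> : t :\ x = [set y; z] by [].
  by rewrite /t -setUA setU1K // !inE negb_or xy xz.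
apply/idP/eqP => [/forall_inP H|E].
  by have /forall_inP/(_ z) := H y (set21 y z); rewrite set22 => /(_ isT)/eqP.
apply/forall_inP => a; rewrite !inE => /orP[]/eqP->;
  apply/forall_inP => b; rewrite !inE => /orP[]/eqP->; rewrite ?E ?eqxx //.
Qed.

(** The three counts add up to 2, so two of them agree but not all three:
    exactly one vertex is balanced.  Crossing an edge permutes the counts in the
    same way as the vertices, hence preserves the balanced vertex. *)
Lemma middle_choice_project (v0 : V) : exists m', middle_choice K m'.
Proof.
pose m' (t : {set V}) : V := odflt v0 [pick v in t | balanced t v].
have m'P x y z : [set x; y; z] \in triangles K ->
    m' [set x; y; z] \in [set x; y; z]
    /\ (m' [set x; y; z] == x) = balanced [set x; y; z] x.
  move=> Kt; have [xy xz yz] := triangle_distinct Kt.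
  set t := [set x; y; z] in Kt *.
  have bx : balanced t x = (lifts_over t y == lifts_over t z).
    exact: balancedE.
  have byy : balanced t y = (lifts_over t x == lifts_over t z).
    by move: Kt; rewrite /t set3_swap; apply: balancedE.
  have bz : balanced t z = (lifts_over t x == lifts_over t y).
    by move: Kt; rewrite /t -set3_rot; apply: balancedE.
  have sum2 : lifts_over t x + lifts_over t y + lifts_over t z = 2.
    exact: sum_lifts_over.
  rewrite /m'; case: pickP => [v /andP[tv bv]|none] /=.
    split=> //; move: tv bv; rewrite {1}/t !inE => /orP[/orP[]|]/eqP->.
    - by move=> ->; rewrite eqxx.
    - by rewrite byy bx (eq_sym y) (negPf xy) => e; apply/esym/negbTE; lia.
    - by rewrite bz bx (eq_sym z) (negPf xz) => e; apply/esym/negbTE; lia.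
  have := (none x, none y, none z).
  rewrite /= bx byy bz /t !inE !eqxx !orbT -/t /= => -[[]]; lia.
exists m'; split=> [t Kt|x y z w Kz Kw zw].
  have /set0Pn[v tv] : t != set0.
    by rewrite -card_gt0; move: Kt; rewrite inE => /andP[_ /eqP ->].
  have [a [c Et]] := triangle_shape Kt tv.
  by rewrite Et; apply: (m'P _ _ _ _).1; rewrite -Et.
have [n1 n2 n3] := lifts_over_edge Kz Kw zw.
move=> E; apply/eqP; move: (Kw); rewrite set3_swap => Kw'.
rewrite (m'P _ _ _ Kw').2 balancedE // -set3_swap.
rewrite -n2 -n3 -balancedE // -(m'P _ _ _ Kz).2.
exact/eqP.
Qed.

End Cover.

Theorem theorem6 (V W : finType) (K : {set {set V}}) (L : {set {set W}})
    (pr : W -> V) :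
  surface K -> ~ orientable K -> three_divisible K ->
  orientable_double_cover K L pr ->
  (has_two_circuit_decomposition K <-> has_two_circuit_decomposition L).
Proof.
move=> sK _ _ [sL _ cov].
have [scK /card_gt0P[v0 _] _ _] := sK; have [scL /card_gt0P[w0 _] _ _] := sL.
have [clK clL] := (surface_closed_up sK, surface_closed_up sL).
split=> -[C dC].
  have mK := circuit_middle_choice v0 clK dC.
  have [m mL] := middle_choice_lift scK scL cov w0 mK.
  exact: middle_choice_decomposition mL.
have mL := circuit_middle_choice w0 clL dC.
have [m mK] := middle_choice_project scK scL cov mL v0.
exact: middle_choice_decomposition mK.
Qed.
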